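(* Let $L$ be a relational language with set of relation symbols $\mathcal{R}=\bigcup_{1\le n<\omega}\mathcal{R}_n$ (each $\mathcal{R}_n$ a non-empty set of $n$-ary symbols) such that $|\mathcal{R}_k|>1$ for infinitely many $k\ge 2$. Let $\mathcal{W}$ be a set of allowed diagrams in $L$, and suppose that for every $w\in\mathcal{W}^1$ there are $n<\omega$ and $w_1,w_2\in\mathcal{W}^n$ such that $w\subset w_1$, $w\subset w_2$ and $w_1(n)\ne w_2(n)$. Let $\lambda$ be a cardinal. Then the class $K(\mathcal{W})$ has the amalgamation property for models of size $\lambda$ if and only if it has the disjoint amalgamation property for models of size $\lambda$.
   Context: Notation: $[A]^n$ is the set of $n$-element subsets of $A$, $[A]^{<\omega}$ the set of finite subsets, and $[n]=\{1,\dots,n\}$ (so $[0]=\emptyset$). $|M|$ is the universe of a structure $M$ and $\|M\|$ its cardinality. Let $L$ be a relational language whose set of relation symbols is $\mathcal{R}=\bigcup_{1\le n<\omega}\mathcal{R}_n$, with each $\mathcal{R}_n$ a non-empty set of $n$-ary relation symbols. An $L$-coloring structure is an $L$-structure $M$ for which there is a (coloring) function $c_M$, assigning to each non-empty finite subset of $|M|$ a symbol in $\mathcal{R}$, such that for distinct $a_1,\dots,a_n$ one has $c_M(\{a_1,\dots,a_n\})=P$ iff $M\models P(a_1,\dots,a_n)$. That is, each $P\in\mathcal{R}_n$ is a relation on $n$-element subsets of $|M|$, and the realizations of the symbols in $\mathcal{R}_n$ partition $[|M|]^n$. A substructure $M$ of an $L$-coloring structure $N$ is monochromatic if for each $n\ge1$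 and all $A,B\in[|M|]^n$, $c_N(A)=c_N(B)$. If $M$ is an $n$-element monochromatic structure, its diagram is the function $d_M:[n]\to\mathcal{R}$ with $d_M(k)=c_N(A)$ for any $k$-element subset $A$ of $M$. A set of allowed diagrams is a non-empty set $\mathcal{W}$ of functions $w:[n]\to\mathcal{R}$ ($n<\omega$) with $w(k)\in\mathcal{R}_k$ for $1\le k\le n$, closed under restrictions to $[m]$ for $m\le n$. $\mathcal{W}^n$ is the set of functions in $\mathcal{W}$ with domain $[n]$. The coloring class $K(\mathcal{W})$ is the class of all $L$-coloring structures $N$ such that $d_M\in\mathcal{W}$ for every finite monochromatic substructure $M$ of $N$; it is ordered by the substructure relation. $K=K(\mathcal{W})$ has the amalgamation property for models of size $\lambda$ if for all $M_0,M_1,M_2\in K$ of cardinality $\lambda$ with $M_0$ a substructure of $M_1$ and of $M_2$, there are $N\in K$ and embeddings $f_i:M_i\to N$ ($i=1,2$) with $f_1\restriction M_0=f_2\restriction M_0$. It has the disjoint amalgamation property for models of size $\lambda$ if moreover $N,f_1,f_2$ can always be chosen with $f_1(M_1)\cap f_2(M_2)=f_1(M_0)$. *)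

(* Defs.v *)
From mathcomp Require Import all_boot.
From mathcomp Require Import boolp classical_sets functions cardinality.

Set Implicit Arguments.
Unset Strict Implicit.
Unset Printing Implicit Defensive.

Local Open Scope classical_set_scope.
Local Open Scope card_scope.

Record language := Language {
  symb :> Type;
  arity : symb -> nat;
  arity_gt0 : forall P, 0 < arity P;
  arity_surj : forall n, 0 < n -> exists P, arity P = n }.

Definition symbols_of_arity (L : language) (n : nat) : set L :=
  [set P | arity P = n].

Record structure (L : language) := Structure {
  universe :> Type;
  interp : forall P : L, ('I_(arity P) -> universe) -> Prop }.

Arguments interp {L s} P a.

Definition has_size (L : language) (M : structure L) (lambda : Type) : Prop :=
  [set: M] #= [set: lambda].

(* [A]^n *)
Definition subsets_of_size (T : Type) (A : set T) (n : nat) : set (set T) :=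
  [set B | B `<=` A /\ B #= `I_n].

Definition embedding (L : language) (M N : structure L) (f : M -> N) : Prop :=
  injective f /\
  forall (P : L) (a : 'I_(arity P) -> M),
    interp P a <-> interp P (f \o a).

(* Only the values of c on non-empty finite sets matter; elsewhere c is
   arbitrary. The first two clauses say that each symbol is a relation on
   subsets of size arity P: it never holds of a tuple with repetitions, and on
   injective tuples it depends only on the range. The last clause makes the
   realizations of the n-ary symbols cover, hence partition, [|M|]^n. *)
Definition is_coloring (L : language) (M : structure L) (c : set M -> L) :
    Prop :=
  [/\ forall (P : L) (a : 'I_(arity P) -> M),
        interp P a -> injective a,
      forall (P : L) (a : 'I_(arity P) -> M), injective a ->
        (c (range a) = P <-> interp P a)
    & forall n, 0 < n -> forall A, subsets_of_size [set: M] n A ->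
        symbols_of_arity n (c A)].

Arguments is_coloring {L} M c.

(* The language being relational, substructures of N are given by arbitrary
   subsets of its universe. *)
Definition monochromatic (L : language) (N : structure L) (c : set N -> L)
    (M : set N) : Prop :=
  forall n, 0 < n -> forall A B,
    subsets_of_size M n A -> subsets_of_size M n B -> c A = c B.

Arguments monochromatic {L} N c M.

(* A function on [n] = {1, ..., n} is a function d on 'I_n = {0, ..., n - 1},
   d i being the value at i + 1. *)
Definition is_diagram (L : language) (N : structure L) (c : set N -> L)
    (M : set N) (n : nat) (d : 'I_n -> L) : Prop :=
  forall (i : 'I_n) (A : set N), subsets_of_size M i.+1 A -> d i = c A.

Arguments is_diagram {L} N c M {n} d.

(* v is the restriction of w to [m], i.e. w extends v *)
Definition restricts (L : language) (m n : nat)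
    (v : 'I_m -> L) (w : 'I_n -> L) : Prop :=
  m <= n /\ forall (i : 'I_m) (j : 'I_n), i = j :> nat -> v i = w j.

(* W n is the set of allowed diagrams with domain [n] *)
Definition allowed_diagrams (L : language) (W : forall n, set ('I_n -> L)) :
    Prop :=
  [/\ exists n, W n !=set0,
      forall n (w : 'I_n -> L), W n w ->
        forall i : 'I_n, symbols_of_arity i.+1 (w i)
    & forall m n (v : 'I_m -> L) (w : 'I_n -> L),
        W n w -> restricts v w -> W m v].

(* The coloring c is determined by N on non-empty finite sets, and the diagram
   d by M, so both existentials have a unique relevant witness. *)
Definition coloring_class (L : language) (W : forall n, set ('I_n -> L)) :
    set (structure L) :=
  [set N : structure L | exists c : set N -> L, is_coloring N c /\
     forall (n : nat) (M : set N), M #= `I_n -> monochromatic N c M ->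
       exists2 d : 'I_n -> L, is_diagram N c M d & W n d].

(* As types have no literal inclusion, "M0 is a substructure of M1 and of M2"
   is expressed by embeddings e1 and e2, playing the role of inclusions. *)
Definition amalgamation (L : language) (K : set (structure L))
    (lambda : Type) : Prop :=
  forall (M0 M1 M2 : structure L) (e1 : M0 -> M1) (e2 : M0 -> M2),
    K M0 -> K M1 -> K M2 ->
    has_size M0 lambda -> has_size M1 lambda -> has_size M2 lambda ->
    embedding e1 -> embedding e2 ->
    exists (N : structure L) (f1 : M1 -> N) (f2 : M2 -> N),
      [/\ K N, embedding f1, embedding f2 & f1 \o e1 = f2 \o e2].

Definition disjoint_amalgamation (L : language) (K : set (structure L))
    (lambda : Type) : Prop :=
  forall (M0 M1 M2 : structure L) (e1 : M0 -> M1) (e2 : M0 -> M2),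
    K M0 -> K M1 -> K M2 ->
    has_size M0 lambda -> has_size M1 lambda -> has_size M2 lambda ->
    embedding e1 -> embedding e2 ->
    exists (N : structure L) (f1 : M1 -> N) (f2 : M2 -> N),
      [/\ K N, embedding f1, embedding f2, f1 \o e1 = f2 \o e2
        & range f1 `&` range f2 = range (f1 \o e1)].

(* Main.v *)
Require Import Defs.
From mathcomp Require Import all_boot.
From mathcomp Require Import boolp classical_sets functions cardinality.

Set Implicit Arguments.
Unset Strict Implicit.
Unset Printing Implicit Defensive.

Local Open Scope classical_set_scope.
Local Open Scope card_scope.

(** Disjoint amalgamation trivially gives amalgamation. For the converse, let
    M0 be a substructure of M1 and M2, all of size lambda. If M0 is finite, then
    M1 = M0 and any amalgam is disjoint; so let M0 be infinite.

    A set that is not monochromatic, and whose size is some j, can have its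
    color changed to any other symbol of arity j without creating or destroying
    a monochromatic set: a set containing it is non-monochromatic because of
    its subsets of one fixed size, and if that size is j then the set itself is
    the only one of size j below it ([recolor_homogeneous],
    [recolor_allowed]). This gives control over an amalgam ([separation]).
    Choose T in M0 with m elements, where there are two symbols P <> Q of arity
    m + 1. In M1, give the color P to each non-monochromatic T + a with a
    outside M0; in M2, give them the color Q. Amalgamate the recolored
    structures: if a and b are identified outside M0, then T + a is
    monochromatic, since otherwise the image of T + a = T + b would have both
    colors. Afterwards the original colors are put back inside the amalgam.

    If M0 is not monochromatic, some finite subset of it is not, and T can be
    chosen to contain that subset, because there are arbitrarily large arities
    with two symbols. Then no T + a is monochromatic and the amalgam is
    disjoint.

    If M0 is monochromatic, then points outside M0 can be identified only when
    their color is that of the points of M0. In the amalgam, every point of M2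
    outside M0 with this color is given a second copy, to which M2 is redirected
    ([doubling]). The sets lying in neither M2 nor the old amalgam are colored
    according to their size, with the colors of the subsets of M0. A finite
    monochromatic set of this kind then has the diagram of a subset of M0 of
    the same size, which is allowed. *)

(** * Sizes of finite sets *)

Lemma size_unique (X : Type) (A : set X) (m n : nat) :
  A #= `I_m -> A #= `I_n -> m = n.
Proof.
move=> Am An; apply/card_eq_II; apply: card_eq_trans An.
by rewrite card_eq_sym.
Qed.

Lemma size_setU1 (X : Type) (A : set X) (x : X) (n : nat) :
  ~ A x -> A #= `I_n -> (x |` A) #= `I_n.+1.
Proof.
move=> nAx An; apply/eq_cardSP; exists x; first by left.
suff -> : (x |` A) `\ x = A by [].
apply/seteqP; split=> [y [[->|//] /(_ erefl)//]|y Ay]; split; first by right.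
by move=> yx; apply: nAx; rewrite -yx.
Qed.

Lemma size_sub_eq (X : Type) (A B : set X) (n : nat) :
  A `<=` B -> A #= `I_n -> B #= `I_n -> A = B.
Proof.
move=> sAB An Bn; apply/seteqP; split=> // x Bx; apply: contrapT => nAx.
have : `I_n.+1 #<= `I_n.
  (* x |` A is a subset of B with n + 1 elements *)
  rewrite -(card_le_eql (size_setU1 nAx An)) -(card_le_eqr Bn).
  by apply: subset_card_le => y [->|/sAB].
by rewrite card_le_II ltnn.
Qed.

Lemma size_image (X Y : Type) (f : X -> Y) (A : set X) (n : nat) :
  injective f -> A #= `I_n -> f @` A #= `I_n.
Proof.
move=> injf; apply: card_eq_trans; apply: inj_card_eq => x y _ _.
exact: injf.
Qed.

Lemma size_imageW (X Y : Type) (f : X -> Y) (A : set X) (n : nat) :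
  injective f -> f @` A #= `I_n -> A #= `I_n.
Proof.
move=> injf; apply: card_eq_trans; rewrite card_eq_sym.
by apply: inj_card_eq => x y _ _; apply: injf.
Qed.

(** The last hypothesis says that V has at least j elements, which covers
    finite and infinite V at once. *)
Lemma size_between (X : Type) (U V : set X) (m j : nat) :
    U `<=` V -> U #= `I_m -> m <= j ->
    (forall k, k < j -> ~ (V #= `I_k)) ->
  exists A, [/\ U `<=` A, A `<=` V & A #= `I_j].
Proof.
move=> sUV Um; elim: j => [|j IHj].
  by rewrite leqn0 => /eqP m0 _; exists U; split; rewrite -?m0.
rewrite leq_eqVlt => /predU1P[<- _|lemj Vbig]; first by exists U; split.
have [//|k /ltnW/Vbig//|A [sUA sAV Aj]] := IHj.
have [x Vx nAx] : exists2 x, V x & ~ A x.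
  apply: contrapT => noX; apply: (Vbig j) => //.
  suff <- : A = V by [].
  apply/seteqP; split=> // x Vx; apply: contrapT => nAx; apply: noX.
  by exists x.
exists (x |` A); split; first by move=> y /sUA; right.
- by move=> y [->|/sAV].
- exact: size_setU1.
Qed.

Lemma size_between_finite (X : Type) (U V : set X) (m j n : nat) :
    U `<=` V -> U #= `I_m -> V #= `I_n -> m <= j <= n ->
  exists A, [/\ U `<=` A, A `<=` V & A #= `I_j].
Proof.
move=> sUV Um Vn /andP[lemj lejn]; apply: size_between Um _ _ => // k ltkj Vk.
by move: lejn; rewrite (size_unique Vn Vk) leqNgt ltkj.
Qed.

Lemma size_between_infinite (X : Type) (U V : set X) (m j : nat) :
    U `<=` V -> U #= `I_m -> infinite_set V -> m <= j ->
  exists A, [/\ U `<=` A, A `<=` V & A #= `I_j].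
Proof.
move=> sUV Um infV lemj; apply: size_between Um _ _ => // k _ Vk.
by apply: infV; exists k.
Qed.

Lemma size0 (X : Type) : @set0 X #= `I_0.
Proof. by rewrite II0 card_eq00. Qed.

Lemma size_subset (X : Type) (V : set X) (j n : nat) :
  V #= `I_n -> j <= n -> exists2 A, A `<=` V & A #= `I_j.
Proof.
move=> Vn jn; have [//|A [_ sA Aj]] :=
  size_between_finite (@sub0set _ V) (size0 X) Vn (_ : 0 <= j <= n).
by exists A.
Qed.

Lemma size_infinite (X : Type) (j : nat) :
  infinite_set [set: X] -> exists A : set X, A #= `I_j.
Proof.
move=> infX.
have [//|A [_ _ Aj]] :=
  size_between_infinite (@sub0set _ setT) (size0 X) infX (_ : 0 <= j).
by exists A.
Qed.

Lemma size_enum (X : Type) (A : set X) (n : nat) :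
  A #= `I_n -> exists2 a : 'I_n -> X, injective a & range a = A.
Proof.
move=> An; have /card_bijP[g [h hg gh]] : [set: 'I_n] #= A.
  by rewrite card_eq_sym; apply: card_eq_trans An card_II.
exists (fun i => val (g (exist _ i (in_setT i)))).
  by move=> i j /val_inj/(can_inj hg) [].
apply/seteqP; split=> [_ [i _ <-]|x Ax]; first by apply: set_mem; exact: valP.
have xA : x \in A by apply/mem_set.
case e: (h (exist _ x xA)) => [i iT]; exists i => //.
rewrite (_ : exist _ i _ = h (exist _ x xA)) ?gh //.
by rewrite e; congr exist; apply: bool_irrelevance.
Qed.

Lemma range_comp (I X Y : Type) (f : X -> Y) (a : I -> X) :
  range (f \o a) = f @` range a.
Proof. by rewrite image_comp. Qed.

Lemma size_range (X : Type) (n : nat) (a : 'I_n -> X) :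
  injective a -> range a #= `I_n.
Proof.
by move=> inja; apply: size_image => //; rewrite card_eq_sym card_II.
Qed.

Lemma image_preimage_range (X Y : Type) (f : X -> Y) (A : set Y) :
  A `<=` range f -> f @` (f @^-1` A) = A.
Proof.
move=> sA; apply/seteqP; split=> [_ [x ? <-]//|y Ay].
by have [x _ fx] := sA _ Ay; exists x; rewrite //= /preimage /= fx.
Qed.

Lemma preimage_image_inj (X Y : Type) (f : X -> Y) (A : set X) :
  injective f -> f @^-1` (f @` A) = A.
Proof.
move=> injf; apply/seteqP; split=> [x [y Ay /injf<-]//|x Ax].
by exists x.
Qed.

(** * Colorings and embeddings *)

(** The notions of coloring, monochromatic set and diagram on a bare type: the
    arguments below change colors on a fixed universe, and are about functions
    on sets rather than about the relations of a structure. *)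
Definition homogeneous (L : language) (X : Type) (c : set X -> L) (B : set X) :=
  forall n, 0 < n -> forall A A',
    subsets_of_size B n A -> subsets_of_size B n A' -> c A = c A'.

Definition respects_arity (L : language) (X : Type) (c : set X -> L) :=
  forall n, 0 < n -> forall A : set X, A #= `I_n -> arity (c A) = n.

Definition allowed (L : language) (W : forall n, set ('I_n -> L)) (X : Type)
    (c : set X -> L) :=
  forall (n : nat) (B : set X), B #= `I_n -> homogeneous c B ->
    exists2 d : 'I_n -> L,
      forall (i : 'I_n) (A : set X), subsets_of_size B i.+1 A -> d i = c A
      & W n d.

(** Colorings are arbitrary on empty and on infinite sets, hence the
    restriction to nonempty finite A. *)
Definition preserves_colors (L : language) (X Y : Type) (cX : set X -> L)
    (cY : set Y -> L) (f : X -> Y) :=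
  forall (n : nat) (A : set X), 0 < n -> A #= `I_n -> cY (f @` A) = cX A.

Definition struct_of (L : language) (X : Type) (c : set X -> L) : structure L :=
  @Structure L X (fun P a => injective a /\ c (range a) = P).

Lemma struct_of_coloring (L : language) (X : Type) (c : set X -> L) :
  respects_arity c -> is_coloring (struct_of c) c.
Proof.
move=> arc; split=> [P a []//|P a inja|n n0 A [_ An]].
- by split=> [cP|[]//]; split.
- exact: arc.
Qed.

Lemma is_coloring_arity (L : language) (M : structure L) (c : set M -> L) :
  is_coloring M c -> respects_arity c.
Proof. by move=> [_ _ ar] n n0 A An; apply: ar. Qed.

Lemma struct_of_in_class (L : language) (W : forall n, set ('I_n -> L))
    (X : Type) (c : set X -> L) :
  respects_arity c -> allowed W c -> coloring_class W (struct_of c).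
Proof. by move=> arc ac; exists c; split; first exact: struct_of_coloring. Qed.

(** An n-element set is the range of an injective n-tuple, so an embedding can
    be tested on colors of finite sets instead of on relations. *)
Lemma embedding_colors (L : language) (M N : structure L)
    (cM : set M -> L) (cN : set N -> L) (f : M -> N) :
    is_coloring M cM -> is_coloring N cN ->
  embedding f <-> injective f /\ preserves_colors cM cN f.
Proof.
move=> [injM colM arM] [injN colN arN]; split=> -[injf fP]; split=> //.
- move=> n A n0 An.
  (* enumerate A by a tuple whose length is literally the arity of its color *)
  have := arM n n0 A (conj (@subsetT _ A) An); rewrite /symbols_of_arity /=.
  move=> arA; rewrite -arA in An.
  have [a inja aA] := size_enum An.
  have := (colM _ a inja).1; rewrite aA => /(_ erefl)/fP.
  have injfa : injective (f \o a) by apply: inj_comp.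
  by move=> /(colN _ _ injfa).2; rewrite range_comp aA.
- move=> P a; split=> Pa.
  + have inja := injM _ _ Pa.
    have injfa : injective (f \o a) by apply: inj_comp.
    apply/(colN _ _ injfa); rewrite range_comp (fP (arity P)) ?arity_gt0 //.
      exact/(colM _ _ inja).
    exact: size_range.
  + have injfa := injN _ _ Pa.
    have inja : injective a by move=> i j aij; apply: injfa; rewrite /= aij.
    apply/(colM _ _ inja); rewrite -(fP (arity P)) ?arity_gt0 //.
      by rewrite -range_comp; apply/(colN _ _ injfa).
    exact: size_range.
Qed.

Lemma homogeneous_sub (L : language) (X : Type) (c : set X -> L) (A B : set X) :
  A `<=` B -> homogeneous c B -> homogeneous c A.
Proof.
move=> sAB hB n n0 A1 A2 [sA1 A1n] [sA2 A2n].
by apply: (hB n) => //; split=> //; apply: subset_trans sAB.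
Qed.

Lemma homogeneous_image (L : language) (X Y : Type) (cX : set X -> L)
    (cY : set Y -> L) (f : X -> Y) (B : set X) :
    injective f -> preserves_colors cX cY f ->
  homogeneous cY (f @` B) <-> homogeneous cX B.
Proof.
move=> injf fP; split=> hB n n0 A1 A2 [sA1 A1n] [sA2 A2n].
  rewrite -(fP n A1) // -(fP n A2) //.
  by apply: (hB n) => //; split; try exact: size_image; apply: image_subset.
have im A : A `<=` f @` B -> f @` (B `&` f @^-1` A) = A.
  move=> sA; apply/seteqP; split=> [_ [x [_ Ax] <-]//|y Ay].
  by have [x Bx fx] := sA _ Ay; exists x; rewrite //= /preimage /= fx.
rewrite -(im _ sA1) -(im _ sA2).
have sz A : A `<=` f @` B -> A #= `I_n -> B `&` f @^-1` A #= `I_n.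
  by move=> sA An; apply: (size_imageW injf); rewrite im.
rewrite !(fP n) ?sz //.
by apply: (hB n) => //; split; rewrite ?sz //; apply: subIsetl.
Qed.

(** The diagram of a homogeneous set is determined by a single subset of each
    size, so that comparing one pair of subsets for each size is enough. *)
Lemma allowed_transfer (L : language) (W : forall n, set ('I_n -> L))
    (X Y : Type) (cX : set X -> L) (cY : set Y -> L) (n : nat) (B : set X)
    (B' : set Y) :
    allowed W cX -> B #= `I_n -> homogeneous cX B -> homogeneous cY B' ->
    (forall j, 0 < j <= n -> exists A A',
       [/\ subsets_of_size B j A, subsets_of_size B' j A' & cX A = cY A']) ->
  exists2 d : 'I_n -> L,
    forall (i : 'I_n) (A : set Y), subsets_of_size B' i.+1 A -> d i = cY A
    & W n d.
Proof.
move=> ac Bn hB hB' same; have [d dB Wd] := ac n B Bn hB.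
exists d => // i A AB'.
have [|A1 [A' [A1B A'B' c1]]] := same i.+1; first exact: ltn_ord.
by rewrite (dB _ _ A1B) c1; apply: (hB' i.+1).
Qed.

Lemma allowed_transfer_image (L : language) (W : forall n, set ('I_n -> L))
    (X Y : Type) (cX : set X -> L) (cY : set Y -> L) (f : X -> Y) (n : nat)
    (B' : set Y) :
    injective f -> preserves_colors cX cY f -> allowed W cX ->
    B' `<=` range f -> B' #= `I_n -> homogeneous cY B' ->
  exists2 d : 'I_n -> L,
    forall (i : 'I_n) (A : set Y), subsets_of_size B' i.+1 A -> d i = cY A
    & W n d.
Proof.
move=> injf fP ac sB B'n hB'.
have eB : B' = f @` (f @^-1` B').
  apply/seteqP; split=> [y B'y|_ [x ? <-]//].
  by have [x _ fx] := sB _ B'y; exists x; rewrite //= /preimage /= fx.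
have Bn : f @^-1` B' #= `I_n by apply: (size_imageW injf); rewrite -eB.
have hB : homogeneous cX (f @^-1` B').
  by apply/(homogeneous_image _ injf fP); rewrite -eB.
apply: (allowed_transfer ac Bn hB hB') => j /andP[j0 jn].
have [A sA Aj] := size_subset Bn jn.
exists A, (f @` A); split; [by split| |by rewrite (fP j)].
by split; [move=> _ [x /sA ? <-]|apply: size_image].
Qed.

(** * Changing the colors of non-monochromatic sets *)

(** If a subset A of B were recolored, two of its subsets of some size k would
    have different old colors. If k <> j these colors are unchanged, and B is
    not homogeneous for c'; if k = j both subsets are A itself. *)
Lemma recolor_homogeneous (L : language) (X : Type) (c c' : set X -> L)
    (j : nat) :
    (forall n A, 0 < n -> A #= `I_n -> c' A <> c A ->
       A #= `I_j /\ ~ homogeneous c A) ->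
  forall n B, B #= `I_n -> homogeneous c' B ->
   forall i A, 0 < i -> subsets_of_size B i A -> c' A = c A.
Proof.
move=> cc' n B Bn hB i A i0 [sAB Ai]; apply: contrapT => nA.
have [Aj] := cc' i A i0 Ai nA; apply=> k k0 A1 A2 [sA1 A1k] [sA2 A2k].
have [ekj|kj] := eqVneq k j.
  move: A1k A2k; rewrite ekj => A1j A2j.
  by rewrite (size_sub_eq sA1 A1j Aj) (size_sub_eq sA2 A2j Aj).
have unchanged A' : A' #= `I_k -> c' A' = c A'.
  move=> A'k; apply: contrapT => /(cc' k A' k0 A'k) [A'j _].
  by move: kj; rewrite (size_unique A'k A'j) eqxx.
rewrite -!unchanged //; apply: (hB k) => //; split=> //.
- exact: subset_trans sAB.
- exact: subset_trans sAB.
Qed.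

Lemma recolor_homogeneousE (L : language) (X : Type) (c c' : set X -> L)
    (j : nat) :
    (forall n A, 0 < n -> A #= `I_n -> c' A <> c A ->
       A #= `I_j /\ ~ homogeneous c A) ->
  forall n B, B #= `I_n -> homogeneous c' B <-> homogeneous c B.
Proof.
move=> cc' n B Bn; split=> hB k k0 A1 A2 sA1 sA2.
  by rewrite -!(recolor_homogeneous cc' Bn hB k0) //; apply: (hB k).
have unchanged A : subsets_of_size B k A -> c' A = c A.
  move=> [sA Ak]; apply: contrapT => /(cc' k A k0 Ak) [_]; apply.
  exact: homogeneous_sub hB.
by rewrite !unchanged //; apply: (hB k).
Qed.

Lemma recolor_allowed (L : language) (W : forall n, set ('I_n -> L))
    (X : Type) (c c' : set X -> L) (j : nat) :
    (forall n A, 0 < n -> A #= `I_n -> c' A <> c A ->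
       A #= `I_j /\ ~ homogeneous c A) ->
  allowed W c -> allowed W c'.
Proof.
move=> cc' ac n B Bn hB; have hB0 := (recolor_homogeneousE cc' Bn).1 hB.
have [d dB Wd] := ac n B Bn hB0; exists d => // i A AB.
by rewrite (recolor_homogeneous cc' Bn hB _ AB) //; apply: dB.
Qed.

(** * Amalgams of colorings *)

Definition coloring_in (L : language) (W : forall n, set ('I_n -> L))
    (X : Type) (c : set X -> L) :=
  respects_arity c /\ allowed W c.

Definition color_embedding (L : language) (X Y : Type) (cX : set X -> L)
    (cY : set Y -> L) (f : X -> Y) :=
  injective f /\ preserves_colors cX cY f.

Definition amalgamates (L : language) (W : forall n, set ('I_n -> L))
    (X0 X1 X2 Y : Type) (c1 : set X1 -> L) (c2 : set X2 -> L) (cY : set Y -> L)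
    (e1 : X0 -> X1) (e2 : X0 -> X2) (f1 : X1 -> Y) (f2 : X2 -> Y) :=
  [/\ coloring_in W cY, color_embedding c1 cY f1, color_embedding c2 cY f2
    & f1 \o e1 = f2 \o e2].

(** When the two ranges meet, [paste] favors [c1]; the compatibility hypothesis
    of [paste_spec] makes this choice immaterial. The coloring [c] takes care
    of the sets contained in neither range. *)
Definition paste (L : language) (X1 X2 Y : Type) (c1 : set X1 -> L)
    (c2 : set X2 -> L) (f1 : X1 -> Y) (f2 : X2 -> Y) (c : set Y -> L) :
    set Y -> L :=
  fun A => if `[< A `<=` range f1 >] then c1 (f1 @^-1` A)
           else if `[< A `<=` range f2 >] then c2 (f2 @^-1` A) else c A.

Lemma paste_spec (L : language) (X1 X2 Y : Type) (c1 : set X1 -> L)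
    (c2 : set X2 -> L) (f1 : X1 -> Y) (f2 : X2 -> Y) (c : set Y -> L) :
    injective f1 -> injective f2 ->
    (forall n A1 A2, 0 < n -> A1 #= `I_n -> f1 @` A1 = f2 @` A2 ->
       c1 A1 = c2 A2) ->
    respects_arity c1 -> respects_arity c2 -> respects_arity c ->
  [/\ respects_arity (paste c1 c2 f1 f2 c),
      color_embedding c1 (paste c1 c2 f1 f2 c) f1
    & color_embedding c2 (paste c1 c2 f1 f2 c) f2].
Proof.
move=> inj1 inj2 compat ar1 ar2 ar.
split; [|split=> // n A n0 An|split=> // n A n0 An].
- move=> n n0 A An; rewrite /paste.
  case: asboolP => s1.
    apply: ar1 => //; apply: (size_imageW inj1).
    by rewrite image_preimage_range.
  case: asboolP => s2; last exact: ar.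
  by apply: ar2 => //; apply: (size_imageW inj2); rewrite image_preimage_range.
- by rewrite /paste asboolT ?preimage_image_inj // => _ [x _ <-]; exists x.
- rewrite /paste; case: asboolP => s1.
    apply: (compat n) => //; last by rewrite image_preimage_range.
    apply: (size_imageW inj1); rewrite image_preimage_range //.
    exact: size_image.
  by rewrite asboolT ?preimage_image_inj // => _ [x _ <-]; exists x.
Qed.

Lemma amalgamation_colorings (L : language) (W : forall n, set ('I_n -> L))
    (lambda : Type) :
    amalgamation (coloring_class W) lambda ->
  forall (X0 X1 X2 : Type) (c0 : set X0 -> L) (c1 : set X1 -> L)
      (c2 : set X2 -> L) (e1 : X0 -> X1) (e2 : X0 -> X2),
    coloring_in W c0 -> coloring_in W c1 -> coloring_in W c2 ->
    [set: X0] #= [set: lambda] -> [set: X1] #= [set: lambda] ->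
    [set: X2] #= [set: lambda] ->
    color_embedding c0 c1 e1 -> color_embedding c0 c2 e2 ->
  exists (Y : Type) (cY : set Y -> L) (f1 : X1 -> Y) (f2 : X2 -> Y),
    amalgamates W c1 c2 cY e1 e2 f1 f2.
Proof.
move=> AP X0 X1 X2 c0 c1 c2 e1 e2 [ar0 al0] [ar1 al1] [ar2 al2].
move=> s0 s1 s2 e1P e2P.
have colP X (c : set X -> L) : respects_arity c -> is_coloring (struct_of c) c.
  exact: struct_of_coloring.
have [||N [f1 [f2 [[cN [colN alN]] f1P f2P f12]]]] :=
  @AP (struct_of c0) (struct_of c1) (struct_of c2) e1 e2
      (struct_of_in_class ar0 al0) (struct_of_in_class ar1 al1)
      (struct_of_in_class ar2 al2) s0 s1 s2.
- by apply/(embedding_colors _ (colP _ _ ar0) (colP _ _ ar1)).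
- by apply/(embedding_colors _ (colP _ _ ar0) (colP _ _ ar2)).
exists N, cN, f1, f2; split=> //.
- by split=> //; exact: is_coloring_arity.
- exact/(embedding_colors _ (colP _ _ ar1) colN).
- exact/(embedding_colors _ (colP _ _ ar2) colN).
Qed.

(** * Separating points by recoloring *)

(** The sets T + a whose color is altered in order to tell the points of the two
    sides apart; homogeneous ones cannot be altered freely. *)
Definition flagged (L : language) (X0 X : Type) (e : X0 -> X) (T : set X0)
    (c : set X -> L) : set (set X) :=
  [set A | exists a, [/\ ~ range e a, A = a |` e @` T & ~ homogeneous c A]].

Definition flag (L : language) (X0 X : Type) (e : X0 -> X) (T : set X0)
    (c : set X -> L) (P : L) : set X -> L :=
  fun A => if `[< flagged e T c A >] then P else c A.

Lemma flagE (L : language) (X0 X : Type) (e : X0 -> X) (T : set X0)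
    (c : set X -> L) (P : L) (A : set X) :
  ~ flagged e T c A -> flag e T c P A = c A.
Proof. by move=> nA; rewrite /flag asboolF. Qed.

Lemma flagged_size (L : language) (X0 X : Type) (e : X0 -> X) (T : set X0)
    (c : set X -> L) (m : nat) (A : set X) :
  injective e -> T #= `I_m -> flagged e T c A -> A #= `I_m.+1.
Proof.
move=> inje Tm [a [na -> _]]; apply: size_setU1; last exact: size_image.
by move=> [t _ ta]; apply: na; exists t.
Qed.

Lemma flag_changes (L : language) (X0 X : Type) (e : X0 -> X) (T : set X0)
    (c : set X -> L) (m : nat) (P : L) :
    injective e -> T #= `I_m ->
  forall n A, 0 < n -> A #= `I_n -> flag e T c P A <> c A ->
    A #= `I_m.+1 /\ ~ homogeneous c A.
Proof.
move=> inje Tm n A _ _; rewrite /flag; case: asboolP => // fA _.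
by split; [exact: flagged_size fA | have [a []] := fA].
Qed.

Lemma flag_coloring_in (L : language) (W : forall n, set ('I_n -> L))
    (X0 X : Type) (e : X0 -> X) (T : set X0) (c : set X -> L) (m : nat) (P : L) :
    injective e -> T #= `I_m -> arity P = m.+1 ->
  coloring_in W c -> coloring_in W (flag e T c P).
Proof.
move=> inje Tm arP [arc ac]; split.
  move=> n n0 A An; rewrite /flag; case: asboolP => [fA|_]; last exact: arc.
  by rewrite arP; apply: size_unique An; exact: flagged_size fA.
exact: (recolor_allowed (flag_changes (P := P) inje Tm) ac).
Qed.

(** Flagged sets contain a point outside the base, so that recoloring them
    leaves the base a substructure. *)
Lemma flag_embedding (L : language) (X0 X : Type) (e : X0 -> X) (T : set X0)
    (c0 : set X0 -> L) (c : set X -> L) (P : L) :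
  color_embedding c0 c e -> color_embedding c0 (flag e T c P) e.
Proof.
move=> [inje eP]; split=> // n A n0 An; rewrite flagE; first exact: (eP n).
move=> [a [na eA _]]; apply: na.
have : (e @` A) a by rewrite eA; left.
by move=> [x _ <-]; exists x.
Qed.

(** Flagged sets receive the color P on one side and Q on the other, so an
    amalgam of the recolored structures cannot identify a with b when T + a and
    T + b are flagged. Restoring the colors in that amalgam is again a change at
    non-homogeneous sets of size m + 1, hence harmless. *)
Lemma separation (L : language) (W : forall n, set ('I_n -> L)) (lambda : Type)
    (X0 X1 X2 : Type) (c0 : set X0 -> L) (c1 : set X1 -> L) (c2 : set X2 -> L)
    (e1 : X0 -> X1) (e2 : X0 -> X2) (T : set X0) (m : nat) (P Q : L) :
    amalgamation (coloring_class W) lambda ->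
    coloring_in W c0 -> coloring_in W c1 -> coloring_in W c2 ->
    [set: X0] #= [set: lambda] -> [set: X1] #= [set: lambda] ->
    [set: X2] #= [set: lambda] ->
    color_embedding c0 c1 e1 -> color_embedding c0 c2 e2 ->
    T #= `I_m -> arity P = m.+1 -> arity Q = m.+1 -> P <> Q ->
  exists (Y : Type) (cY : set Y -> L) (f1 : X1 -> Y) (f2 : X2 -> Y),
    amalgamates W c1 c2 cY e1 e2 f1 f2 /\
    forall a b, f1 a = f2 b -> range e1 a \/ homogeneous c1 (a |` e1 @` T).
Proof.
move=> AP in0 in1 in2 s0 s1 s2 e1P e2P Tm arP arQ PQ.
have [inje1 _] := e1P; have [inje2 _] := e2P.
have d1in := flag_coloring_in inje1 Tm arP in1.
have d2in := flag_coloring_in inje2 Tm arQ in2.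
have [Y [cN [f1 [f2 [inN f1P f2P f12]]]]] :=
  amalgamation_colorings AP in0 d1in d2in s0 s1 s2
    (flag_embedding T P e1P) (flag_embedding T Q e2P).
have [injf1 colf1] := f1P; have [injf2 colf2] := f2P.
have f12x x : f1 (e1 x) = f2 (e2 x) by exact: (congr1 (@^~ x) f12).
have nrange a b : f1 a = f2 b -> range e1 a <-> range e2 b.
  move=> ab; split=> -[x _ xE]; exists x => //.
    by apply: injf2; rewrite -f12x xE.
  by apply: injf1; rewrite f12x xE.
have glued a b : f1 a = f2 b -> ~ range e1 a ->
    homogeneous c1 (a |` e1 @` T) /\ homogeneous c2 (b |` e2 @` T).
  move=> ab na; have nb : ~ range e2 b by move=> /(nrange _ _ ab).
  have eqS : f1 @` (a |` e1 @` T) = f2 @` (b |` e2 @` T).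
    by rewrite !image_setU !image_set1 !image_comp ab f12.
  have size1 : (a |` e1 @` T) #= `I_m.+1.
    apply: size_setU1; last exact: size_image.
    by move=> [t _ ta]; apply: na; exists t.
  have size2 : (b |` e2 @` T) #= `I_m.+1.
    apply: size_setU1; last exact: size_image.
    by move=> [t _ ta]; apply: nb; exists t.
  (* the two sets have the same image, and flagging preserves homogeneity *)
  have h12 : homogeneous c1 (a |` e1 @` T) <-> homogeneous c2 (b |` e2 @` T).
    rewrite -(recolor_homogeneousE (flag_changes (P := P) inje1 Tm) size1).
    rewrite -(recolor_homogeneousE (flag_changes (P := Q) inje2 Tm) size2).
    rewrite -(homogeneous_image _ injf1 colf1) -(homogeneous_image _ injf2 colf2).
    by rewrite eqS.
  suff h1 : homogeneous c1 (a |` e1 @` T) by split=> //; exact/h12.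
  apply: contrapT => nh1; apply: PQ.
  have nh2 : ~ homogeneous c2 (b |` e2 @` T) by move=> /h12.
  transitivity (cN (f1 @` (a |` e1 @` T))).
    by rewrite (colf1 m.+1) // /flag asboolT //; exists a.
  by rewrite eqS (colf2 m.+1) // /flag asboolT //; exists b.
(* sets identified in the amalgam are not flagged: a flagged T + a that lies in
   both ranges would have its point a glued, and so would be homogeneous *)
have compat n A1 A2 :
    0 < n -> A1 #= `I_n -> f1 @` A1 = f2 @` A2 -> c1 A1 = c2 A2.
  move=> n0 A1n A12.
  have A2n : A2 #= `I_n.
    by apply: (size_imageW injf2); rewrite -A12; exact: size_image.
  have nf1 : ~ flagged e1 T c1 A1.
    move=> [a [na A1E]]; apply; rewrite A1E.
    have : (f2 @` A2) (f1 a) by rewrite -A12 A1E; exists a => //; left.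
    by move=> [b _ ba]; have [] := glued a b (esym ba) na.
  have nf2 : ~ flagged e2 T c2 A2.
    move=> [b [nb A2E]]; apply; rewrite A2E.
    have : (f1 @` A1) (f2 b) by rewrite A12 A2E; exists b => //; left.
    move=> [a _ ab]; have [] := glued a b ab; last by [].
    by move=> /(nrange _ _ ab).
  by rewrite -(flagE P nf1) -(flagE Q nf2) -(colf1 n) // -(colf2 n) // A12.
have [arP' p1 p2] := paste_spec injf1 injf2 compat in1.1 in2.1 inN.1.
exists Y, (paste c1 c2 f1 f2 cN), f1, f2; split; last first.
  move=> a b ab; have [r|nr] := pselect (range e1 a); first by left.
  by right; have [] := glued a b ab nr.
split=> //; split=> //; apply: recolor_allowed inN.2 => n A n0 An.
have changed X (c : set X -> L) e f R : injective f -> injective e ->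
    preserves_colors (flag e T c R) cN f -> A `<=` range f ->
    c (f @^-1` A) <> cN A -> A #= `I_m.+1 /\ ~ homogeneous cN A.
  move=> injf inje colf sA; have An' : f @^-1` A #= `I_n.
    by apply: (size_imageW injf); rewrite image_preimage_range.
  rewrite -{2}(image_preimage_range sA) (colf n) // => /nesym cA.
  have [sz nh] := flag_changes inje Tm n0 An' cA.
  rewrite -(image_preimage_range sA); split; first exact: size_image.
  move=> /(homogeneous_image _ injf colf).
  by move=> /(recolor_homogeneousE (flag_changes (P := R) inje Tm) An').
rewrite /paste; case: asboolP => [sA|_]; first exact: (changed _ _ e1 f1 P).
by case: asboolP => [sA|//]; exact: (changed _ _ e2 f2 Q).
Qed.

(** * Doubling over a homogeneous base *)

(** The points of X2 that the given amalgam may identify with points of X1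
    outside the base all lie in the set D of those colored like the points of
    the base, and Z adds to Y a new copy of each point of D. A finite
    homogeneous B contained neither in Y nor in the image of X2 contains a new
    point p and a point q outside that image. Since p has the color of the points of the base, so do all points of
    B; and for each j >= 2 a subset of B of size j containing p and q is colored
    by size, as the subsets of the base are. Hence B has an allowed diagram. *)
Lemma doubling (L : language) (W : forall n, set ('I_n -> L))
    (X0 X1 X2 Y : Type) (c0 : set X0 -> L) (c1 : set X1 -> L) (c2 : set X2 -> L)
    (cY : set Y -> L) (e1 : X0 -> X1) (e2 : X0 -> X2) (f1 : X1 -> Y)
    (f2 : X2 -> Y) :
    infinite_set [set: X0] -> homogeneous c0 [set: X0] ->
    coloring_in W c0 -> coloring_in W c2 ->
    amalgamates W c1 c2 cY e1 e2 f1 f2 ->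
    (forall a b, f1 a = f2 b ->
       range e1 a \/ exists x : X0, c1 [set a] = c0 [set x]) ->
  exists (Z : Type) (cZ : set Z -> L) (g1 : X1 -> Z) (g2 : X2 -> Z),
    amalgamates W c1 c2 cZ e1 e2 g1 g2 /\
    forall a b, g1 a = g2 b -> range e1 a.
Proof.
move=> infX0 h0 [ar0 al0] in2 [inY [injf1 colf1] [injf2 colf2] f12] glued.
pose D : set X2 := [set y | ~ range e2 y /\ exists x, c2 [set y] = c0 [set x]].
pose Z : Type := (Y + {y : X2 | D y})%type.
pose g2 (y : X2) : Z :=
  if pselect (D y) is left Dy then inr (exist _ y Dy) else inl (f2 y).
have g2D y (Dy : D y) : g2 y = inr (exist _ y Dy).
  by rewrite /g2; case: pselect => // Dy'; rewrite (Prop_irrelevance Dy' Dy).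
have g2N y : ~ D y -> g2 y = inl (f2 y) by rewrite /g2; case: pselect.
pose inY1 : Y -> Z := inl.
have injl : injective inY1 by move=> y y' [].
have injg2 : injective g2.
  move=> y y'.
  have [Dy|nDy] := pselect (D y); have [Dy'|nDy'] := pselect (D y').
  - by rewrite (g2D _ Dy) (g2D _ Dy') => -[].
  - by rewrite (g2D _ Dy) (g2N _ nDy').
  - by rewrite (g2N _ nDy) (g2D _ Dy').
  - by rewrite (g2N _ nDy) (g2N _ nDy') => -[/injf2].
(* the common color of the subsets of the base that have the size of A *)
pose c (A : set Z) : L := c0 (get [set S : set X0 | S #= A]).
have sub0 n : exists S : set X0, S #= `I_n by exact: size_infinite.
have cE n (A : set Z) (S : set X0) :
    0 < n -> A #= `I_n -> S #= `I_n -> c A = c0 S.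
  move=> n0 An Sn; rewrite /c; apply: (h0 n) => //; split=> //.
  apply: card_eq_trans (An); apply: (@getPex _ [set S : set X0 | S #= A]).
  by exists S; apply: card_eq_trans Sn _; rewrite card_eq_sym.
have arc : respects_arity c.
  by move=> n n0 A An; have [S Sn] := sub0 n; rewrite (cE n A S) //; apply: ar0.
have compat n A1 A2 :
    0 < n -> A1 #= `I_n -> inY1 @` A1 = g2 @` A2 -> cY A1 = c2 A2.
  move=> n0 A1n A12; suff eA : A1 = f2 @` A2.
    rewrite eA; apply: (colf2 n) => //.
    by apply: (size_imageW injf2); rewrite -eA.
  have nD y : A2 y -> ~ D y.
    move=> A2y Dy; have : (inY1 @` A1) (g2 y) by rewrite A12; exists y.
    by rewrite (g2D _ Dy) => -[].
  rewrite -[LHS](preimage_image_inj _ injl) A12.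
  apply/seteqP; split=> [z [y A2y]|_ [y A2y <-]].
    by rewrite (g2N _ (nD _ A2y)) => -[<-]; exists y.
  by exists y => //; rewrite (g2N _ (nD _ A2y)).
have [arZ inlP g2P] := paste_spec injl injg2 compat inY.1 in2.1 arc.
pose cZ := paste cY c2 inY1 g2 c; rewrite -/cZ in arZ inlP g2P.
have [_ colinl] := inlP; have [_ colg2] := g2P.
have alZ : allowed W cZ.
  move=> n B Bn hB; have [sB|nsB1] := pselect (B `<=` range inY1).
    exact: (allowed_transfer_image injl colinl inY.2 sB Bn hB).
  have [sB|nsB2] := pselect (B `<=` range g2).
    exact: (allowed_transfer_image injg2 colg2 in2.2 sB Bn hB).
  have [p Bp np] : exists2 p, B p & ~ range inY1 p.
    apply: contrapT => no; apply: nsB1 => z Bz.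
    by apply: contrapT => nz; apply: no; exists z.
  have [q Bq nq] : exists2 q, B q & ~ range g2 q.
    apply: contrapT => no; apply: nsB2 => z Bz.
    by apply: contrapT => nz; apply: no; exists z.
  have [y [Dy pE]] : exists y, D y /\ p = g2 y.
    move: np; case: (p) => [y []|[y Dy] _]; first by exists y.
    by exists y; split=> //; rewrite (g2D _ Dy).
  have [S Sn] := sub0 n.
  apply: (allowed_transfer al0 Sn _ hB); first exact: homogeneous_sub h0.
  move=> j /andP[j0 jn].
  have [S' sS' S'j] := size_subset Sn jn.
  exists S'; have [ej|j1] := eqVneq j 1.
    rewrite ej in S'j *; exists [set p]; split=> //.
      by split; [move=> _ ->|exact: card_set1].
    rewrite pE -image_set1 (colg2 1) //; last exact: card_set1.
    have [x ->] := Dy.2; apply: (h0 1) => //; split=> //; exact: card_set1.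
  have pq2 : p |` [set q] #= `I_2.
    apply: size_setU1; last exact: card_set1.
    by move=> pq; apply: nq; rewrite -pq pE; exists y.
  have spq : p |` [set q] `<=` B by move=> _ [->|->].
  have le2j : 2 <= j <= n by rewrite jn andbT; case: j j0 j1 {S'j jn} => [|[]].
  have [A [sA AB Aj]] := size_between_finite spq pq2 Bn le2j.
  exists A; split=> //; rewrite /cZ /paste asboolF; last first.
    by move=> /(_ p (sA _ (or_introl erefl))).
  rewrite asboolF; last by move=> /(_ q (sA _ (or_intror erefl))).
  by rewrite (cE j A S').
have comp (X : Type) (cX : set X -> L) f :
    injective f -> preserves_colors cX cY f ->
    color_embedding cX cZ (inY1 \o f).
  move=> injf colf; split; first exact: inj_comp.
  move=> n A n0 An; rewrite -image_comp (colinl n) ?(colf n) //.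
  exact: size_image.
have ne2 x : ~ D (e2 x) by move=> [[]]; exists x.
exists Z, cZ, (inY1 \o f1), g2; split.
  split=> //; first exact: comp.
  apply/funext => x /=; rewrite (g2N _ (ne2 x)); congr inl.
  exact: (congr1 (@^~ x) f12).
move=> a b; have [Db|nDb] := pselect (D b); first by rewrite /= (g2D _ Db).
rewrite /= (g2N _ nDb) => -[ab]; have [//|[x ax]] := glued a b ab.
have [[x' _ bE]|nb] := pselect (range e2 b).
  exists x' => //; apply: injf1; rewrite ab -bE.
  exact: (congr1 (@^~ x') f12).
case: nDb; split=> //; exists x; rewrite -ax.
rewrite -(colf1 1 [set a]) ?card_set1 // -(colf2 1 [set b]) ?card_set1 //.
by rewrite !image_set1 ab.
Qed.

(** * Amalgamation and disjoint amalgamation *)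

Theorem proposition1p11 (L : language)
  (hL : infinite_set [set k : nat | 2 <= k /\
     exists P Q : L,
       [/\ symbols_of_arity k P, symbols_of_arity k Q & P <> Q]])
  (W : forall n : nat, set ('I_n -> L))
  (hW : allowed_diagrams W)
  (hbranch : forall w : 'I_1 -> L, W 1 w ->
     exists (n : nat) (w1 w2 : 'I_n.+1 -> L),
       [/\ W n.+1 w1, W n.+1 w2, restricts w w1, restricts w w2
         & w1 ord_max <> w2 ord_max])
  (lambda : Type) :
  amalgamation (coloring_class W) lambda <->
  disjoint_amalgamation (coloring_class W) lambda.
Proof.
split=> [AP|DAP] M0 M1 M2 e1 e2 K0 K1 K2 s0 s1 s2 E1 E2; last first.
  have [N [f1 [f2 [KN F1 F2 f12 _]]]] :=
    DAP _ _ _ _ _ K0 K1 K2 s0 s1 s2 E1 E2.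
  by exists N, f1, f2.
suff [N [f1 [f2 [[KN F1 F2 f12] disj]]]] :
    exists (N : structure L) (f1 : M1 -> N) (f2 : M2 -> N),
    [/\ coloring_class W N, embedding f1, embedding f2 & f1 \o e1 = f2 \o e2] /\
    forall a b, f1 a = f2 b -> range e1 a.
  exists N, f1, f2; split=> //; apply/seteqP.
  split=> [_ [[a _ <-] [b _ /esym/disj]]|_ [x _ <-]].
    by move=> [x _ <-]; exists x.
  split; [by exists (e1 x)|exists (e2 x) => //].
  by rewrite -[RHS]/((f1 \o e1) x) f12.
have [finM0|infM0] := pselect (finite_set [set: M0]).
  have [N [f1 [f2 AN]]] := AP _ _ _ _ _ K0 K1 K2 s0 s1 s2 E1 E2.
  exists N, f1, f2; split=> // a b _; have [n M0n] := finM0.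
  suff -> : range e1 = setT by [].
  apply: (size_sub_eq (n := n)) => //; first exact: (size_image E1.1 M0n).
  apply: card_eq_trans s1 _; apply: card_eq_trans M0n.
  by rewrite card_eq_sym.
have [c0 [col0 al0]] := K0; have [c1 [col1 al1]] := K1; have [c2 [col2 al2]] := K2.
have ar0 := is_coloring_arity col0; have ar1 := is_coloring_arity col1.
have ar2 := is_coloring_arity col2.
have e1P := (embedding_colors _ col0 col1).1 E1.
have e2P := (embedding_colors _ col0 col2).1 E2.
suff [Y [cY [f1 [f2 [[inY f1P f2P f12] disj]]]]] :
    exists (Y : Type) (cY : set Y -> L) (f1 : M1 -> Y) (f2 : M2 -> Y),
    amalgamates W c1 c2 cY e1 e2 f1 f2 /\ forall a b, f1 a = f2 b -> range e1 a.
  exists (struct_of cY), f1, f2; split=> //.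
  have colY := struct_of_coloring inY.1; split=> //.
  - exact: struct_of_in_class inY.1 inY.2.
  - exact/(embedding_colors _ col1 colY).
  - exact/(embedding_colors _ col2 colY).
have large n : exists m (P Q : L),
    [/\ n < m.+1, 1 < m.+1, arity P = m.+1, arity Q = m.+1 & P <> Q].
  apply: contrapT => no; apply: hL; apply: (sub_finite_set _ (finite_II n.+1)).
  move=> k [k2 [P [Q [Pk Qk PQ]]]]; rewrite /= ltnS leqNgt; apply/negP => nk.
  apply: no; exists k.-1, P, Q; rewrite prednK //; exact: ltn_trans k2.
have sep T m P Q := @separation L W lambda M0 M1 M2 c0 c1 c2 e1 e2 T m P Q AP
  (conj ar0 al0) (conj ar1 al1) (conj ar2 al2) s0 s1 s2 e1P e2P.
have [h0|nh0] := pselect (homogeneous c0 [set: M0]).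
  (* T is any nonempty subset of M0 of a suitable size: if T + a is
     monochromatic then a has the color of the points of T *)
  have [m [P [Q [_ m1 arP arQ PQ]]]] := large 0.
  have [T Tm] := size_infinite m infM0.
  have [Y [cY [f1 [f2 [am gl]]]]] := sep T m P Q Tm arP arQ PQ.
  apply: (doubling infM0 h0 (conj ar0 al0) (conj ar2 al2) am).
  move=> a b /gl [|hom]; first by left.
  right; have [t Tt] : T !=set0.
    apply/set0P/negP => /eqP T0; have m0 : 0 = m.
      by apply: size_unique Tm; rewrite T0; exact: size0.
    by rewrite -m0 in m1.
  exists t; rewrite -(e1P.2 1) ?card_set1 // image_set1.
  apply: (hom 1) => //; split; rewrite ?card_set1 //.
  by move=> _ ->; right; exists t.
have [T0 [n T0n nT0]] : exists T0 : set M0,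
    exists2 n, T0 #= `I_n & ~ homogeneous c0 T0.
  apply: contrapT => no; apply: nh0 => k k0 A B [_ Ak] [_ Bk].
  have [n ABn] : finite_set (A `|` B) by rewrite finite_setU; split; exists k.
  have hAB : homogeneous c0 (A `|` B).
    by apply: contrapT => nAB; apply: no; exists (A `|` B), n.
  by apply: (hAB k) => //; split.
have [m [P [Q [nm _ arP arQ PQ]]]] := large n.
have [//|T [sT0T _ Tm]] :=
  size_between_infinite (@subsetT _ T0) T0n infM0 (_ : n <= m).
have [Y [cY [f1 [f2 [am gl]]]]] := sep T m P Q Tm arP arQ PQ.
exists Y, cY, f1, f2; split=> // a b /gl[//|hom]; case: nT0.
apply: (homogeneous_sub sT0T); apply/(homogeneous_image _ e1P.1 e1P.2).
by apply: homogeneous_sub hom => x Tx; right.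
Qed.
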